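(* Let $n,\lambda\ge2$ be even integers, $m=1+\frac{\lambda}{2}$, $\sigma>0$, $b_0>0$ and $0<\delta<\frac{b_0}{2(m+1)}$. Let $\rho$, $c_0$, $c_1$ and the function $MN:[c_0,\infty)\to(0,\infty)$ (for the class $E_\sigma$) be as defined in the context. If $1+\lambda-n\ge0$, then the optimal choice of $c\in[c_0,\infty)$ is $c^*\in[c_0,c_1]$ which minimizes $MN$ on $[c_0,c_1]$; that is, a minimizer $c^*$ of $MN$ on $[c_0,c_1]$ exists, and any such $c^*$ minimizes $MN$ over $[c_0,\infty)$.
   Context: The constant $\rho$ is: $\rho=1+\frac{s}{2m+3}$ with $s=\lceil\frac{n-\lambda-3}{2}\rceil$ if $n-\lambda>3$; $\rho=1$ if $n-\lambda\le3$. $c_0:=24\rho(m+1)\delta$, $c_1:=12\rho b_0$. The MN function (for functions in $E_\sigma$, with $b_0$ fixed) is $$MN(c)=\begin{cases}\sqrt{8\rho}\,c^{\frac{\lambda-n-1}{4}}\sup_{\xi\in R^n}\Big\{|\xi|^{\frac{1+n+\lambda}{4}}e^{\frac{c|\xi|}{2}-\frac{|\xi|^2}{2\sigma}}\Big\}\left(\frac23\right)^{\frac{c}{24\rho\delta}} & c_0\le c\le c_1,\\[1ex] \sqrt{\frac{2}{3b_0}}\,c^{\frac{1+\lambda-n}{4}}\sup_{\xi\in R^n}\Big\{|\xi|^{\frac{1+n+\lambda}{4}}e^{\frac{c|\xi|}{2}-\frac{|\xi|^2}{2\sigma}}\Big\}\left(\frac23\right)^{\frac{b_0}{2\delta}}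 & c_1\le c<\infty,\end{cases}$$ where $|\xi|$ is the Euclidean norm. The two formulas agree at $c=c_1$. A value of $c\in[c_0,\infty)$ is called optimal if it minimizes $MN$ over $[c_0,\infty)$. *)

(* Defs.v *)
From mathcomp Require Import all_boot all_order all_algebra.
From mathcomp Require Import all_classical all_reals all_analysis.

Set Implicit Arguments.
Unset Strict Implicit.
Unset Printing Implicit Defensive.
Import Order.TTheory GRing.Theory Num.Theory.
Local Open Scope classical_set_scope.
Local Open Scope ring_scope.

(* The canonical norm of 'rV[R]_n is the max norm, hence this definition. *)
Definition euclidean_norm (R : realType) (n : nat) (xi : 'rV[R]_n) : R :=
  Num.sqrt (\sum_(i < n) xi ord0 i ^+ 2).

Definition m_const (R : realType) (lambda : nat) : R := 1 + lambda%:R / 2.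

(* n - lambda is a difference in R, not truncated subtraction in nat. *)
Definition rho_const (R : realType) (n lambda : nat) : R :=
  if 3 < n%:R - lambda%:R :> R then
    1 + (Num.ceil ((n%:R - lambda%:R - 3) / 2 : R))%:~R
        / (2 * m_const R lambda + 3)
  else 1.

Definition c0_const (R : realType) (n lambda : nat) (delta : R) : R :=
  24 * rho_const R n lambda * (m_const R lambda + 1) * delta.

Definition c1_const (R : realType) (n lambda : nat) (b0 : R) : R :=
  12 * rho_const R n lambda * b0.

(* For sigma > 0 the set is nonempty and bounded above (the Gaussian factor
   dominates), so the real-valued [sup] is the genuine supremum. *)
Definition MN_sup (R : realType) (n lambda : nat) (sigma c : R) : R :=
  sup [set euclidean_norm xi `^ ((1 + n%:R + lambda%:R) / 4)
           * expR (c * euclidean_norm xi / 2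
                   - euclidean_norm xi ^+ 2 / (2 * sigma)) | xi in [set: 'rV[R]_n]].

(* Meaningful for c >= c0 only; the two formulas agree at c = c1. *)
Definition MN (R : realType) (n lambda : nat) (sigma b0 delta c : R) : R :=
  let rho := rho_const R n lambda in
  if c <= c1_const n lambda b0 then
    Num.sqrt (8 * rho) * c `^ ((lambda%:R - n%:R - 1) / 4)
    * MN_sup n lambda sigma c
    * (2 / 3) `^ (c / (24 * rho * delta))
  else
    Num.sqrt (2 / (3 * b0)) * c `^ ((1 + lambda%:R - n%:R) / 4)
    * MN_sup n lambda sigma c
    * (2 / 3) `^ (b0 / (2 * delta)).

Definition minimizes_on (R : realType) (f : R -> R) (A : set R) (c : R) : Prop :=
  A c /\ forall x, A x -> f c <= f x.

(* Main.v *)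
Require Import Defs.
From mathcomp Require Import all_boot all_order all_algebra.
From mathcomp Require Import all_classical all_reals all_analysis.
From mathcomp Require Import ring lra.
Import Order.TTheory GRing.Theory Num.Theory.
Import numFieldNormedType.Exports.
Local Open Scope classical_set_scope.
Local Open Scope ring_scope.

(** Since [n - lambda <= 1] we have [rho = 1].  The supremum in [MN] is
    nondecreasing and locally Lipschitz in [c], so [MN] is continuous on the
    compact interval [c0, c1] and attains its minimum there.  Beyond [c1],
    [MN] is a constant times [c `^ ((1 + lambda - n) / 4)] times that supremum,
    a product of nonnegative nondecreasing functions, so [MN c1 <= MN c]. *)

(** For [r > 0] this is [ln r <= r], multiplied by [p] and exponentiated. It trades a power for an
    exponential of a linear term, which a Gaussian can absorb. *)
Lemma powR_le_expR (R : realType) (r p : R) :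
  0 <= r -> 0 <= p -> r `^ p <= expR (p * r).
Proof.
move=> r0 p0; rewrite /powR; case: eqVneq => [->|rn0].
  by rewrite mulr0 expR0; case: (p == 0).
have r_gt0 : 0 < r by rewrite lt_neqAle eq_sym rn0.
by rewrite ler_expR ler_wpM2l // ltW // ln_sublinear.
Qed.

(** Completing the square: the exponents differ by [(sigma * k - r) ^+ 2 / (2 * sigma)]. *)
Lemma expR_mul_gauss_le (R : realType) (sigma k r : R) : 0 < sigma ->
  expR (k * r - r ^+ 2 / (2 * sigma)) <= expR (sigma * k ^+ 2 / 2).
Proof.
move=> s0; rewrite ler_expR -subr_ge0.
have -> : sigma * k ^+ 2 / 2 - (k * r - r ^+ 2 / (2 * sigma))
    = (sigma * k - r) ^+ 2 / (2 * sigma) by field; rewrite gt_eqF.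
by rewrite divr_ge0 ?sqr_ge0// mulr_ge0// ltW.
Qed.

(** Convexity: the graph of [expR] lies above its tangent at [u]. *)
Lemma expR_sub_le (R : realType) (u v : R) : expR u - expR v <= expR u * (u - v).
Proof.
have -> : expR v = expR u * expR (v - u) by rewrite -expRD; congr expR; ring.
have := expR_ge1Dx (v - u); have := expR_gt0 u; nra.
Qed.

Lemma euclidean_norm_ge0 (R : realType) (n : nat) (xi : 'rV[R]_n) :
  0 <= euclidean_norm xi.
Proof. exact: sqrtr_ge0. Qed.

Section MN_sup_theory.
Variables (R : realType) (n lambda : nat) (sigma : R).
Hypothesis sigma_gt0 : 0 < sigma.

Let a : R := (1 + n%:R + lambda%:R) / 4.

Let a_ge0 : 0 <= a.
Proof. by rewrite divr_ge0// !addr_ge0. Qed.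

Let term (c r : R) : R := r `^ a * expR (c * r / 2 - r ^+ 2 / (2 * sigma)).

Let values (c : R) : set R :=
  [set term c (euclidean_norm xi) | xi in [set: 'rV[R]_n]].

(** The power of [r] is at most [expR (a * r)], so the linear coefficient in the exponent becomes
    [a + c / 2], and completing the square gives a bound free of [r]. *)
Let term_le (c r : R) : 0 <= r ->
  term c r <= expR (sigma * (a + c / 2) ^+ 2 / 2).
Proof.
move=> r0; apply: le_trans (@expR_mul_gauss_le R sigma (a + c / 2) r sigma_gt0).
have -> : (a + c / 2) * r - r ^+ 2 / (2 * sigma) =
  a * r + (c * r / 2 - r ^+ 2 / (2 * sigma)) by ring.
by rewrite expRD ler_wpM2r ?expR_ge0// powR_le_expR.
Qed.

Let values_ubound (c : R) : has_ubound (values c).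
Proof.
exists (expR (sigma * (a + c / 2) ^+ 2 / 2)) => _ [xi _ <-].
by apply: term_le; exact: euclidean_norm_ge0.
Qed.

Let values_neq0 (c : R) : values c !=set0.
Proof. by exists (term c (euclidean_norm (0 : 'rV[R]_n))), 0. Qed.

Let term_le_MN_sup (c : R) (xi : 'rV[R]_n) :
  term c (euclidean_norm xi) <= MN_sup n lambda sigma c.
Proof. by apply: (ub_le_sup (values_ubound c)); exists xi. Qed.

Lemma MN_sup_ge0 (c : R) : 0 <= MN_sup n lambda sigma c.
Proof.
apply: le_trans (term_le_MN_sup c 0).
by rewrite mulr_ge0 ?powR_ge0 ?expR_ge0.
Qed.

Lemma le_MN_sup (c d : R) : c <= d ->
  MN_sup n lambda sigma c <= MN_sup n lambda sigma d.
Proof.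
move=> cd; apply: ge_sup (values_neq0 c) _ => _ [xi _ <-].
apply: le_trans (term_le_MN_sup d xi).
rewrite ler_wpM2l ?powR_ge0// ler_expR lerD2r ler_wpM2r//.
by rewrite ler_wpM2r ?euclidean_norm_ge0.
Qed.

(* [r * r `^ a] is dominated by [expR ((a + 1) * r)], which the Gaussian factor
   absorbs; hence the terms are Lipschitz in [c] uniformly in [r]. *)
Lemma MN_sup_lipschitz (c d b : R) : c <= d -> d <= b ->
  MN_sup n lambda sigma d - MN_sup n lambda sigma c
    <= expR (sigma * (a + 1 + b / 2) ^+ 2 / 2) * (d - c).
Proof.
move=> cd db; rewrite lerBlDr.
apply: ge_sup (values_neq0 d) _ => _ [xi _ <-].
rewrite -lerBlDr; have := term_le_MN_sup c xi.
have := @euclidean_norm_ge0 R n xi; move: (euclidean_norm xi) => r r0 tc.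
apply: (@le_trans _ _ (term d r - term c r)); first by rewrite lerB.
rewrite /term -mulrBr.
set u := d * r / 2 - _; set v := c * r / 2 - _.
apply: (@le_trans _ _ (r `^ a * (expR u * (u - v)))).
  by rewrite ler_wpM2l ?powR_ge0// expR_sub_le.
have -> : u - v = r / 2 * (d - c) by rewrite /u /v; ring.
rewrite [expR u * _]mulrA [X in X <= _]mulrA ler_wpM2r ?subr_ge0//.
apply: le_trans (@expR_mul_gauss_le R sigma (a + 1 + b / 2) r sigma_gt0).
(* The three summands bound, in turn, the power of [r], [expR u] and [r / 2]; then [d <= b] and
   [0 <= r] bring the exponent below the completed-square form. *)
apply: (@le_trans _ _ (expR (a * r + u + r))); last first.
  by rewrite ler_expR /u; nra.
rewrite !expRD mulrA ler_pM ?mulr_ge0 ?expR_ge0 ?powR_ge0 ?invr_ge0//.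
  by rewrite ler_wpM2r ?expR_ge0// powR_le_expR.
by have := expR_ge1Dx r; lra.
Qed.

Lemma continuous_MN_sup : continuous (MN_sup n lambda sigma : R -> R).
Proof.
(* [L] is a Lipschitz constant for all arguments up to [c + 1], hence for [d] within distance 1 of
   [c] on either side. *)
move=> c; pose L := expR (sigma * (a + 1 + (c + 1) / 2) ^+ 2 / 2).
have L0 : 0 < L by exact: expR_gt0.
apply/cvgrPdist_le => e e0; near=> d.
have dc1 : `|c - d| <= 1.
  by near: d; apply: (@cvgr_dist_le _ R^o _ _ _ id) => //; exact: cvg_id.
have dce : `|c - d| <= e / L.
  near: d; apply: (@cvgr_dist_le _ R^o _ _ _ id); last by rewrite divr_gt0.
  exact: cvg_id.
have Lcd : L * `|c - d| <= e by rewrite mulrC -ler_pdivlMr.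
apply: le_trans Lcd; have [cd|/ltW dc] := leP c d.
- rewrite !ler0_norm ?subr_le0 ?le_MN_sup// !opprB.
  apply: MN_sup_lipschitz => //; move: dc1; rewrite ler_norml; lra.
- rewrite !ger0_norm ?subr_ge0 ?le_MN_sup//.
  by apply: MN_sup_lipschitz => //; lra.
Unshelve. all: by end_near. Qed.
End MN_sup_theory.

Lemma rho_const_le3 (R : realType) (n lambda : nat) :
  n%:R - lambda%:R <= 3 :> R -> rho_const R n lambda = 1.
Proof. by move=> h; rewrite /rho_const ltNge h. Qed.

Section MN_theory.
Variables (R : realType) (n lambda : nat) (sigma b0 delta : R).
Hypothesis sigma_gt0 : 0 < sigma.
Hypothesis b0_gt0 : 0 < b0.
Hypothesis delta_gt0 : 0 < delta.
Hypothesis rho_gt0 : 0 < rho_const R n lambda.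

Let c1 : R := c1_const n lambda b0.
Let rho : R := rho_const R n lambda.

Lemma c1_const_gt0 : 0 < c1.
Proof. by rewrite !mulr_gt0. Qed.

Lemma within_continuous_MN (c : R) : 0 < c ->
  {within `[c, c1], continuous (MN n lambda sigma b0 delta : R -> R)}.
Proof.
(* On the interval only the first branch of [MN] occurs, and [0 < c] keeps [x] away from 0, so each
   power is an exponential of a logarithm; [g] is the resulting branch-free form. *)
move=> c0; pose g (x : R) := Num.sqrt (8 * rho)
  * expR ((lambda%:R - n%:R - 1) / 4 * ln x) * MN_sup n lambda sigma x
  * expR (x / (24 * rho * delta) * ln (2 / 3)).
apply: (@subspace_eq_continuous _ _ _ (g : R -> R)).
  move=> x; rewrite inE /= in_itv /= => /andP[cx xc1].
  have x0 : x != 0 by rewrite gt_eqF// (lt_le_trans c0).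
  by rewrite /from_subspace /MN /g xc1 /powR (negbTE x0) ifF// mulf_eq0 invr_eq0 !pnatr_eq0.
apply: continuous_in_subspaceT => x; rewrite inE /= in_itv /= => /andP[cx _].
have x0 : 0 < x by exact: lt_le_trans cx.
apply: cvgM; last first.
  apply: cvg_comp; last exact: continuous_expR.
  by apply: cvgMl; apply: cvgMl; exact: cvg_id.
apply: cvgM; last exact: continuous_MN_sup.
apply: cvgMr; apply: cvg_comp; last exact: continuous_expR.
by apply: cvgMr; exact: continuous_ln.
Qed.

(* At [c1] the two formulas agree, because [c1 `^ (1 / 2) = sqrt (12 rho b0)]. *)
Lemma MN_ge_c1 (c : R) : c1 <= c ->
  MN n lambda sigma b0 delta c =
  Num.sqrt (2 / (3 * b0)) * c `^ ((1 + lambda%:R - n%:R) / 4)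
    * MN_sup n lambda sigma c * (2 / 3) `^ (b0 / (2 * delta)).
Proof.
rewrite le_eqVlt => /orP[/eqP <-|c1c]; last by rewrite /MN leNgt c1c.
rewrite /MN lexx -/rho -/c1; congr (_ * _ * _ `^ _); last first.
  rewrite /c1 /c1_const -/rho; field; rewrite !gt_eqF//.
have -> : (1 + lambda%:R - n%:R) / 4 = 2^-1 + (lambda%:R - n%:R - 1) / 4 :> R.
  by field.
rewrite powRD ?(gt_eqF c1_const_gt0) ?implybT// powR12_sqrt ?(ltW c1_const_gt0)//.
rewrite mulrA -sqrtrM ?divr_ge0 ?mulr_ge0 ?(ltW b0_gt0)//.
by congr (Num.sqrt _ * _); rewrite /c1 /c1_const -/rho; field; rewrite gt_eqF.
Qed.

Lemma le_MN_c1 (c : R) : 0 <= 1 + lambda%:R - n%:R :> R -> c1 <= c ->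
  MN n lambda sigma b0 delta c1 <= MN n lambda sigma b0 delta c.
Proof.
move=> nl c1c; rewrite !MN_ge_c1// ler_wpM2r ?powR_ge0//.
rewrite ler_pM ?mulr_ge0 ?sqrtr_ge0 ?powR_ge0 ?MN_sup_ge0 ?le_MN_sup//.
have c1_ge0 := ltW c1_const_gt0.
rewrite ler_wpM2l ?sqrtr_ge0// ge0_ler_powR ?divr_ge0 ?nnegrE//.
exact: le_trans c1c.
Qed.
End MN_theory.

Theorem mainTheorem7 (R : realType) (n lambda : nat) (sigma b0 delta : R)
    (hn : (2 <= n)%N) (hn_even : ~~ odd n)
    (hlambda : (2 <= lambda)%N) (hlambda_even : ~~ odd lambda)
    (hsigma : 0 < sigma) (hb0 : 0 < b0)
    (hdelta : 0 < delta) (hdelta_b0 : delta < b0 / (2 * (m_const R lambda + 1)))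
    (hnlambda : 0 <= 1 + lambda%:R - n%:R :> R) :
  let f : R -> R := MN n lambda sigma b0 delta in
  let c0 : R := c0_const n lambda delta in
  let c1 : R := c1_const n lambda b0 in
  (exists cstar : R, minimizes_on f `[c0, c1] cstar) /\
  (forall cstar : R, minimizes_on f `[c0, c1] cstar ->
     minimizes_on f `[c0, +oo[ cstar).
Proof.
move=> f c0 c1.
have rho1 : rho_const R n lambda = 1 by apply: rho_const_le3; lra.
have rho_gt0 : 0 < rho_const R n lambda by rewrite rho1.
have m1_gt0 : 0 < m_const R lambda + 1 by rewrite /m_const; have := ler0n R lambda; lra.
have c0_gt0 : 0 < c0 by rewrite !mulr_gt0.
(* With [rho = 1] this reads [24 * (m + 1) * delta <= 12 * b0], which is the upper bound assumed on
   [delta]. *)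
have c01 : c0 <= c1.
  move: hdelta_b0; rewrite /c0 /c1 /c0_const /c1_const rho1.
  rewrite ltr_pdivlMr ?mulr_gt0//; lra.
have cf := @within_continuous_MN R n lambda sigma b0 delta hsigma c0 c0_gt0.
split.
  by have [c cI cmin] := EVT_min c01 cf; exists c.
move=> c [] /=; rewrite in_itv /= => /andP[c0c cc1] cmin; split.
  by rewrite /= in_itv /= c0c.
move=> x /=; rewrite in_itv /= andbT => c0x.
(* For [x] beyond [c1], the comparison goes through [f c1]: the endpoint [c1] lies in the compact
   interval, so [f c <= f c1 <= f x]. *)
have [xc1|/ltW c1x] := leP x c1; first by apply: cmin; rewrite /= in_itv /= c0x.
apply: le_trans (@le_MN_c1 R n lambda sigma b0 delta _ _ _ _ _ _ c1x) => //.
by apply: cmin; rewrite /= in_itv /= c01 lexx.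
Qed.
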